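(* Let $X$ be a normed linear space with closed unit ball $B_X$ (a metric space with the metric inherited from $X$). The following statements are equivalent: (i) $\operatorname{rpc} X\le\omega$. (ii) $X$ has the uniform Stone property. (iii) $X$ has the coarse Stone property. (iv) $X$ admits a coarse embedding into $c_0(\Gamma)$ for some set $\Gamma$. (v) $X$ admits a uniform embedding into $c_0(\Gamma)$ for some set $\Gamma$. (vi) $X$ admits a bi-Lipschitz embedding into $c_0(\Gamma)$ for some set $\Gamma$. (vii) $\operatorname{rpc} B_X\le\omega$. (viii) $B_X$ admits a uniform embedding into $c_0(\Gamma)$ for some set $\Gamma$. (ix) $B_X$ admits a bi-Lipschitz embedding into $c_0(\Gamma)$ for some set $\Gamma$.
   Context: Let $M$ be a metric space; $U(x,r)$ denotes the open ball with centre $x$ and radius $r$. A covering of $M$ is a collection $\mathcal U$ of subsets of $M$ with $\bigcup\mathcal U=M$. It is point-finite if every $x\in M$ belongs to only finitely many members of $\mathcal U$. A covering $\mathcal V$ is a refinement of a covering $\mathcal U$ if for every $V\in\mathcal V$ there is $U\in\mathcal U$ with $V\subset U$. A covering $\mathcal U$ is uniform if there is $r>0$ such that the covering $\{U(x,r): x\in M\}$ is a refinement of $\mathcal U$. It is uniformly bounded if there is $R>0$ with $\operatorname{diam}U\le R$ for every $U\in\mathcal U$. $M$ has the uniform Stone property if every uniform covering of $M$ has a point-finite uniform refinement. $M$ has the coarse Stone property if every uniformly bounded covering of $M$ is a refinement of some point-finite uniformly bounded covering of $M$. For a collection $\mathcal E$ of subsets of a set, its order $\operatorname{ord}\mathcal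 E$ is defined as follows: $\operatorname{ord}\mathcal E=n$ if $n=\max\{\operatorname{card}\mathcal D:\mathcal D\subset\mathcal E,\ \bigcap\mathcal D\ne\emptyset\}$ exists and is a natural number; otherwise $\operatorname{ord}\mathcal E$ is the infinite cardinal $\sup\{(\operatorname{card}\mathcal D)^+:\mathcal D\subset\mathcal E,\ \bigcap\mathcal D\neq\emptyset\}$, where $\kappa^+$ denotes the successor cardinal of $\kappa$. The reduced point character $\operatorname{rpc} M$ is the least cardinal $\alpha$ such that every uniform covering of $M$ has a uniform refinement $\mathcal V$ with $\operatorname{ord}\mathcal V\le\alpha$. Let $f\colon (M,\rho)\to(N,\sigma)$ be a mapping between metric spaces. It is a coarse embedding (not necessarily one-to-one) if: for every $d>0$ there is $K\ge0$ such that $\sigma(f(x),f(y))\le K$ whenever $\rho(x,y)\le d$; and for every $K>0$ there is $d>0$ such that $\sigma(f(x),f(y))\ge K$ whenever $\rho(x,y)\ge d$. It is a uniform embedding if it is one-to-one and both $f$ and $f^{-1}$ (defined on $f(M)$) are uniformly continuous. It is a bi-Lipschitz embedding if it is one-to-one and both $f$ and $f^{-1}$ are Lipschitz. $c_0(\Gamma)$ is the Banach space of scalar functions $x$ on $\Gamma$ such that $\{\gamma\in\Gamma:|x(\gamma)|>\varepsilon\}$ is finite for every $\varepsilon>0$, with the supremum norm. *)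

(* Defs.v *)
From HB Require Import structures.
From mathcomp Require Import all_boot all_order all_algebra.
From mathcomp Require Import all_classical all_reals all_analysis.
From mathcomp Require Import complex.

Set Implicit Arguments.
Unset Strict Implicit.
Unset Printing Implicit Defensive.

Import Order.TTheory GRing.Theory Num.Theory.
Import numFieldNormedType.Exports.

Local Open Scope classical_set_scope.
Local Open Scope ring_scope.
Local Open Scope card_scope.

(* Metrics take their values in the scalar field K, as norms do in the library;
   an element r of R[i] with 0 < r or 0 <= r is real, so quantifying over
   positive elements of K is quantifying over positive reals. *)

Definition real_or_complex (R : realType) (K : numFieldType) : Prop :=
  K = (R : numFieldType) \/ K = (R[i] : numFieldType).

Section normed_metric.
Context {K : numFieldType} (X : normedModType K).

Let dist (x y : X) : K := `|y - x|.

Let dist_ge0 x y : 0 <= dist x y.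
Proof. exact: normr_ge0. Qed.

Let dist_positivity x y : dist x y = 0 -> x = y.
Proof. by move/normr0_eq0/eqP; rewrite subr_eq0 => /eqP. Qed.

Let ballEdist x d : ball x d = [set y | dist x y < d].
Proof.
by rewrite -ball_normE; apply/seteqP; split => y /=; rewrite /dist distrC.
Qed.

HB.instance Definition _ := PseudoMetric_isMetric.Build K X
  dist_ge0 dist_positivity ballEdist.

End normed_metric.

Section metric_subspace.
Context {K : numFieldType} {M : metricType K}.
Implicit Types x y z : M.

Lemma mdistC x y : mdist x y = mdist y x.
Proof.
have real_le u v : ~ (mdist u v < mdist v u).
  move=> uv; have : ball u (mdist v u) v by rewrite ballEmdist.
  by move/ball_sym; rewrite ballEmdist /= ltxx.
have : mdist x y >=< mdist y x by apply: real_comparable; exact/ger0_real/mdist_ge0.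
by case/comparable_ltgtP => // /real_le.
Qed.

Lemma mdist_self x : mdist x x = 0.
Proof.
apply/eqP; rewrite eq_le mdist_ge0 andbT; apply/ler_addgt0Pl => e e0.
by have := ballxx x e0; rewrite ballEmdist /= addr0 => /ltW.
Qed.

Lemma mdist_trg y x z : mdist x z <= mdist x y + mdist y z.
Proof.
apply/ler_addgt0Pl => e e0; apply: ltW.
have e20 : 0 < e / 2 by rewrite divr_gt0.
have := @ball_triangle _ _ y x z (mdist x y + e / 2) (mdist y z + e / 2).
rewrite !ballEmdist /= addrACA -splitr !ltrDl => /(_ e20 e20).
by rewrite addrC.
Qed.

Definition metric_subspace (A : set M) : Type := set_type A.

Variable A : set M.

HB.instance Definition _ := Choice.on (metric_subspace A).

Let sdist (u v : metric_subspace A) : K := mdist (set_val u) (set_val v).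

Let sdistxx u : sdist u u = 0. Proof. exact: mdist_self. Qed.

Let sdist_positivity u v : sdist u v = 0 -> u = v.
Proof. by move/mdist_positivity/val_inj. Qed.

Let sdistC u v : sdist u v = sdist v u. Proof. exact: mdistC. Qed.

Let sdist_triangle v u w : sdist u w <= sdist u v + sdist v w.
Proof. exact: mdist_trg. Qed.

HB.instance Definition _ := isMetric.Build K (metric_subspace A)
  sdistxx sdist_positivity sdistC sdist_triangle.

End metric_subspace.

Definition unit_ball {K : numFieldType} (X : normedModType K) :=
  metric_subspace [set x : X | `|x| <= 1].

Section c0.
Context (K : numFieldType) (Gamma : Type).

Definition c0_pred : {pred Gamma -> K^o} :=
  fun x => `[< forall e : K, 0 < e -> finite_set [set g | e < `|x g|] >].

Let c0_closed : submod_closed c0_pred.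
Proof.
split=> [|a x y /asboolP x0 /asboolP y0].
  apply/asboolP => e e0; rewrite (_ : mkset _ = set0) //.
  by apply/seteqP; split => g //=; rewrite normr0 => /(lt_trans e0); rewrite ltxx.
apply/asboolP => e e0.
have a1 : 0 < `|a| + 1 by rewrite ltr_wpDl.
have e2 : 0 < e / 2 by rewrite divr_gt0.
apply: (@sub_finite_set _ _
  ([set g | e / 2 / (`|a| + 1) < `|x g|] `|` [set g | e / 2 < `|y g|])); last first.
  by rewrite finite_setU; split; [apply: x0; rewrite divr_gt0|exact: y0].
move=> g /= eg; apply: contrapT => /not_orP[/negP xg /negP yg].
have ereal r : 0 < r -> (r : K) \is Num.real by exact: gtr0_real.
move: xg yg; rewrite -!real_leNgt ?normr_real ?ereal ?divr_gt0// => xg yg.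
have {}xg : `|a| * `|x g| <= e / 2.
  rewrite ler_pdivlMr// in xg; apply: le_trans xg.
  by rewrite mulrC ler_wpM2l// lerDl.
move: eg; rewrite real_ltNge ?normr_real ?ereal// => /negP; case.
apply: (le_trans (ler_normD _ _)); rewrite [leRHS]splitr lerD//.
by rewrite normrM.
Qed.

HB.instance Definition _ := GRing.isSubmodClosed.Build K (Gamma -> K^o) c0_pred
  c0_closed.

Definition c0 : Type := {x : Gamma -> K^o | c0_pred x}.

HB.instance Definition _ := SubChoice.on c0.
HB.instance Definition _ := [SubChoice_isSubLmodule of c0 by <:].

Definition c0_norm (x : c0) : K := supremum 0 [set `|\val x g| | g in setT].

Let seq_max (s : seq K) a : {in a :: s, forall u, u \is Num.real} ->
  exists2 m, m \in a :: s & {in a :: s, forall u, u <= m}.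
Proof.
elim: s a => [|b s ih] a real_s.
  by exists a; [exact: mem_head|move=> u; rewrite inE => /eqP->].
have [|m ms mP] := ih b; first by move=> u us; apply: real_s; rewrite inE us orbT.
have ar : a \is Num.real by apply: real_s; exact: mem_head.
have mr : m \is Num.real by apply: real_s; rewrite inE ms orbT.
have [am|ma] := real_leP ar mr.
  exists m; first by rewrite inE ms orbT.
  by move=> u; rewrite inE => /predU1P[->//|/mP].
exists a; first exact: mem_head.
by move=> u; rewrite inE => /predU1P[->//|/mP um]; exact/ltW/(le_lt_trans um).
Qed.

(* The supremum is attained, so it exists over every K. *)
Lemma c0_norm_max (x : c0) (g0 : Gamma) :
  exists2 g1, c0_norm x = `|\val x g1| & forall g, `|\val x g| <= `|\val x g1|.
Proof.
suff [g1 xg1] : exists g1, forall g, `|\val x g| <= `|\val x g1|.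
  exists g1 => //; rewrite /c0_norm /supremum ifF; last first.
    by apply/eqP => /seteqP[/(_ `|\val x g1|) + _]; apply; exists g1.
  apply: (@is_subset1_supremums _ _ [set `|\val x g| | g in setT]); last first.
    by split=> [_ [g _ <-]//|u]; apply; exists g1.
  apply: (@xgetPex _ _ (supremums _)); exists `|\val x g1|.
  by split=> [_ [g _ <-]//|u]; apply; exists g1.
have [[g1 xg1]|x0] := pselect (exists g, \val x g != 0); last first.
  exists g0 => g; suff z h : \val x h = 0 by rewrite !z.
  by apply: contrapT => /eqP xh; apply: x0; exists h.
have e0 : 0 < `|\val x g1| / 2 by rewrite divr_gt0 ?normr_gt0.
have := valP x => /asboolP/(_ _ e0).
move=> /(finite_image (fun g => `|\val x g|)) /finite_seqP[s sE].
have [|m ms mP] := @seq_max s `|\val x g1|.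
  move=> u; rewrite inE => /predU1P[->|us]; first exact: normr_real.
  have : [set` s] u by [].
  by rewrite -sE => -[g _ <-]; exact: normr_real.
have [g2 xg2] : exists g2, `|\val x g2| = m.
  move: ms; rewrite inE => /predU1P[->|us]; first by exists g1.
  have : [set` s] m by [].
  by rewrite -sE => -[g _ <-]; exists g.
exists g2 => g; rewrite xg2.
have [xg|xg] := real_leP (normr_real (\val x g)) (gtr0_real e0).
  apply: (le_trans xg); apply: (@le_trans _ _ `|\val x g1|); last first.
    by apply: mP; exact: mem_head.
  by rewrite ler_pdivrMr// ler_peMr// ler1n.
apply: mP; rewrite inE; apply/orP; right.
have : [set` s] `|\val x g| by rewrite -sE; exists g.
by [].
Qed.

Lemma c0_norm_ge (x : c0) g : `|\val x g| <= c0_norm x.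
Proof. by have [g1 ->] := c0_norm_max x g. Qed.

Lemma c0_norm_empty (x : c0) : (Gamma -> False) -> c0_norm x = 0.
Proof.
move=> G0; rewrite /c0_norm /supremum ifT//.
by apply/eqP/seteqP; split=> // u [g]; have := G0 g.
Qed.

Let inhabited_or_empty : Gamma + (Gamma -> False).
Proof.
have [/cid[g _]|G0] := pselect (exists g : Gamma, True); first by left.
by right=> g; apply: G0; exists g.
Qed.

Let c0_ler_normD x y : c0_norm (x + y) <= c0_norm x + c0_norm y.
Proof.
have [g|G0] := inhabited_or_empty; last by rewrite !c0_norm_empty// addr0.
have [g1 -> _] := c0_norm_max (x + y) g.
by rewrite (le_trans (ler_normD _ _))// lerD ?c0_norm_ge.
Qed.

Let c0_normrZ (a : K) x : c0_norm (a *: x) = `|a| * c0_norm x.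
Proof.
have [g|G0] := inhabited_or_empty; last by rewrite !c0_norm_empty// mulr0.
have [g1 e1 ge1] := c0_norm_max (a *: x) g.
have [g2 e2 ge2] := c0_norm_max x g.
have E h : `|\val (a *: x) h| = `|a| * `|\val x h| by rewrite -normrM.
apply/eqP; rewrite eq_le e1 e2; apply/andP; split; last by rewrite -E ge1.
by rewrite E ler_wpM2l.
Qed.

Let c0_normr0_eq0 x : c0_norm x = 0 -> x = 0.
Proof.
move=> x0; apply/val_inj/funext => g.
by apply/normr0_eq0/eqP; rewrite eq_le normr_ge0 -x0 c0_norm_ge.
Qed.

HB.instance Definition _ := Lmodule_isNormed.Build K c0
  c0_ler_normD c0_normrZ c0_normr0_eq0.
HB.instance Definition _ := Metric.copy c0 (c0 : normedModType K).

End c0.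

Section coverings.
Context {K : numFieldType} {M : metricType K}.
Implicit Types (U V : set (set M)).

Definition covering U : Prop := \bigcup_(A in U) A = [set: M].

Definition point_finite U : Prop :=
  forall x : M, finite_set [set A | U A /\ A x].

Definition refinement V U : Prop :=
  forall A, V A -> exists2 B, U B & A `<=` B.

Definition uniform_covering U : Prop :=
  covering U /\
  exists2 r : K, 0 < r & refinement [set ball x r | x in [set: M]] U.

(* This is diam A <= r, the diameter being the supremum of these distances. *)
Definition diam_le (A : set M) (r : K) : Prop :=
  ubound [set mdist p.1 p.2 | p in A `*` A] r.

Definition uniformly_bounded U : Prop :=
  exists2 r : K, 0 < r & forall A, U A -> diam_le A r.

End coverings.

Definition uniform_stone {K : numFieldType} (M : metricType K) : Prop :=
  forall U : set (set M), uniform_covering U ->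
  exists V : set (set M),
    [/\ uniform_covering V, point_finite V & refinement V U].

Definition coarse_stone {K : numFieldType} (M : metricType K) : Prop :=
  forall U : set (set M), covering U -> uniformly_bounded U ->
  exists V : set (set M),
    [/\ covering V, uniformly_bounded V, point_finite V & refinement U V].

(* A cardinal is represented by any type of that cardinality, hence only up to
   equipotence: omega is nat, the natural number n is `I_n. Accordingly, the
   successor, a supremum, the order of a collection and the reduced point
   character are relations to a type, unique up to equipotence, and an
   inequality for one of these cardinals asserts that it exists and is bounded. *)
Section cardinals.
Implicit Types a b c : Type.

Definition card_leT a b : Prop := [set: a] #<= [set: b].

Definition card_ltT a b : Prop := card_leT a b /\ ~ card_leT b a.

Definition is_succ_card a b : Prop :=
  card_ltT a b /\ forall c, card_ltT a c -> card_leT b c.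

Definition is_sup_card (S : Type -> Prop) a : Prop :=
  (forall b, S b -> card_leT b a) /\
  forall c, (forall b, S b -> card_leT b c) -> card_leT a c.

End cardinals.

Section order_of_collection.
Context {T : Type}.
Implicit Types (E D : set (set T)).

Definition intersecting_in E : set (set (set T)) :=
  [set D | D `<=` E /\ \bigcap_(A in D) A !=set0].

Definition is_max_intersecting E (n : nat) : Prop :=
  (exists2 D, intersecting_in E D & D #= `I_n) /\
  forall D, intersecting_in E D -> D #<= `I_n.

(* In is_succ_card D b, the collection D is coerced to the type of its members,
   which represents card D. *)
Definition is_ord E (a : Type) : Prop :=
  (exists2 n, is_max_intersecting E n & [set: a] #= `I_n) \/
  (~ (exists n, is_max_intersecting E n) /\
   is_sup_card (fun b => exists2 D, intersecting_in E D & is_succ_card D b) a).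

Definition ord_le E (a : Type) : Prop := exists2 b, is_ord E b & card_leT b a.

End order_of_collection.

Section reduced_point_character.
Context {K : numFieldType} (M : metricType K).

Definition has_refinements_of_ord (a : Type) : Prop :=
  forall U : set (set M), uniform_covering U ->
  exists V : set (set M),
    [/\ uniform_covering V, refinement V U & ord_le V a].

Definition is_rpc (a : Type) : Prop :=
  has_refinements_of_ord a /\
  forall b, has_refinements_of_ord b -> card_leT a b.

Definition rpc_le (a : Type) : Prop := exists2 b, is_rpc b & card_leT b a.

End reduced_point_character.

Section embeddings.
Context {K : numFieldType} {M N : metricType K}.

Definition coarse_embedding (f : M -> N) : Prop :=
  (forall d : K, 0 < d -> exists2 k : K, 0 <= k &
     forall x y, mdist x y <= d -> mdist (f x) (f y) <= k) /\
  (forall k : K, 0 < k -> exists2 d : K, 0 < d &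
     forall x y, d <= mdist x y -> k <= mdist (f x) (f y)).

(* For f one-to-one, this says that g is the inverse of f, defined on f(M). *)
Definition range_inverse (f : M -> N) (g : metric_subspace (range f) -> M) :
  Prop := forall u, f (g u) = set_val u.

Definition uniform_embedding (f : M -> N) : Prop :=
  [/\ injective f, unif_continuous f &
      exists2 g, range_inverse (f := f) g & unif_continuous g].

End embeddings.

Definition lipschitz_map {K : numFieldType} {M N : metricType K} (f : M -> N) :
  Prop :=
  exists2 L : K, 0 <= L & forall x y, mdist (f x) (f y) <= L * mdist x y.

Definition bilipschitz_embedding {K : numFieldType} {M N : metricType K}
    (f : M -> N) : Prop :=
  [/\ injective f, lipschitz_map f &
      exists2 g, range_inverse (f := f) g & lipschitz_map g].

(* Main.v *)
(* All nine statements are compared with one self-improving property of X: for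
   some s > 0, every set of diameter at most D is covered by a point-finite family
   of sets of diameter at most D / 2 with Lebesgue number D * s. Iterating the
   halving inside each piece keeps the ratio of the Lebesgue number to the diameter
   bounded, and gluing along annuli then gives, at every scale r, a point-finite
   cover of X with Lebesgue number r and diameters at most C * r. By homogeneity the
   property follows from a point-finite cover at a single scale, of X or of its unit
   ball. The space c0(Gamma) has such a cover, by boxes centred at lattice-valued
   functions, and covers pull back along uniform and coarse embeddings. Conversely,
   the truncated distances to the complements of the members of the covers of scales
   2^n, n an integer, are the coordinates of a bi-Lipschitz embedding into
   c0(Gamma). *)
Require Import Defs.
From HB Require Import structures.
From mathcomp Require Import all_boot all_order all_algebra.
From mathcomp Require Import all_classical all_reals all_analysis.
From mathcomp Require Import complex ring lra zify.

Set Implicit Arguments.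
Unset Strict Implicit.
Unset Printing Implicit Defensive.

Import Order.TTheory GRing.Theory Num.Theory.
Import numFieldNormedType.Exports.

Local Open Scope classical_set_scope.
Local Open Scope ring_scope.
Local Open Scope card_scope.

(** * Cardinals, order and point-finite collections *)

(* [card_leT] without a qualifier is the lemma of cardinality.v. *)
Lemma card_leT_inj (a b : Type) (f : a -> b) : injective f -> Defs.card_leT a b.
Proof.
move=> f_inj; have : f @` [set: a] #= [set: a].
  by apply: inj_card_eq => x y _ _; exact: f_inj.
by move=> fa; rewrite /Defs.card_leT -(card_le_eql fa); exact: card_leT.
Qed.

Lemma inj_card_leT (a b : Type) : Defs.card_leT a b -> exists f : a -> b, injective f.
Proof.
move=> /card_leP[f].
pose i (x : a) : [set: a] := SigSub (mem_set (I : [set: a] x)).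
exists (fun x => \val (f (i x))) => x y /val_inj fxy.
by have [] : i x = i y by apply: (inj (f := f)); rewrite ?inE.
Qed.

Lemma card_leTE (T U : Type) (A : set T) (B : set U) : Defs.card_leT A B = (A #<= B).
Proof.
by rewrite /Defs.card_leT (card_le_eql (card_setT _)) (card_le_eqr (card_setT _)).
Qed.

(* A maximal set of choice functions on which all the projections are injective
   is mapped onto some factor. *)
Lemma least_card (I : Type) (F : I -> Type) (i0 : I) :
  exists i, forall j, Defs.card_leT (F i) (F j).
Proof.
pose P (B : set (forall i, F i)) :=
  forall i x y, B x -> B y -> x i = y i -> x = y.
have [|B [PB Bmax]] := @Zorn_bigcup _ P.
  move=> G GP Gtot i x y [X GX Xx] [Y GY Yy].
  have [XY|YX] := Gtot _ _ GX GY; first by apply: (GP _ GY); first exact: XY.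
  by apply: (GP _ GX) => //; exact: YX.
have [[i iP]|noi] := pselect (exists i, forall a : F i, exists2 x, B x & x i = a).
  have /choice[s sP] : forall a : F i, exists x, B x /\ x i = a.
    by move=> a; have [x] := iP a; exists x.
  exists i => j; apply: (@card_leT_inj _ _ (fun a => s a j)) => a a' saa'.
  have [Ba <-] := sP a; have [Ba' <-] := sP a'.
  by rewrite (PB j (s a) (s a')).
have noB : forall i, {a : F i | forall x, B x -> x i <> a}.
  move=> i; apply: cid; apply: contrapT => h; apply: noi; exists i => a.
  apply: contrapT => h'; apply: h; exists a => x Bx xa; apply: h'; by exists x.
pose z i := sval (noB i); have zP i : forall x, B x -> x i <> z i := svalP (noB i).
(* [z] differs from every member of [B] in every coordinate, so adding it keeps all projections
   injective; the coordinate [i0] shows that [z] is new. *)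
exfalso; apply: (Bmax (B `|` [set z])).
  split; first by move=> x; left.
  move=> /(_ z) h; have Bz : B z by apply: h; right.
  exact: (zP i0 z Bz).
move=> i x y [Bx|->] [By|->] // xy; first exact: PB xy.
- by have := zP i x Bx; rewrite xy.
- by have := zP i y By; rewrite xy.
Qed.

Lemma card_leT_total (a b : Type) : Defs.card_leT a b \/ Defs.card_leT b a.
Proof.
have [[] h] := @least_card bool (fun c => if c then a else b) true.
- by left; exact: (h false).
- by right; exact: (h true).
Qed.

Lemma set_nat_uncountable : ~ Defs.card_leT (set nat) nat.
Proof.
move=> /inj_card_leT[f f_inj].
pose D : set nat := [set n | exists2 A, f A = n & ~ A n].
have nD : ~ D (f D) by move=> /[dup] Df [A /f_inj-> ].
by apply: (nD); exists D.
Qed.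

(** It is the least cardinality of an uncountable subset of [set nat]. The infinite case of the
    order calls for this successor. *)
Lemma succ_card_nat : exists b, is_succ_card nat b.
Proof.
pose uncountable (A : set (set nat)) := ~ Defs.card_leT A nat.
pose I := {A | uncountable A}.
have TI : ~ Defs.card_leT [set: set nat] nat.
  by rewrite /Defs.card_leT (card_le_eql (card_setT _)); exact: set_nat_uncountable.
have [[A Ac] Amin] := @least_card I (fun A => sval A) (exist uncountable _ TI).
exists A; split.
  split=> //; rewrite /Defs.card_leT; apply/infiniteP => Afin; apply: (Ac).
  exact: finite_set_countable.
move=> c [_ ncn].
(* If [c] embeds into [set nat], its range is one of the competitors; otherwise [c] dominates
   [set nat] and hence [A]. *)
have [/inj_card_leT[f f_inj]|cc] := card_leT_total c (set nat); last first.
  by apply: card_le_trans cc; rewrite (card_le_eql (card_setT _)); exact: card_leT.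
have rc : range f #= [set: c] by apply: inj_card_eq => x y _ _; exact: f_inj.
have rI : ~ Defs.card_leT (range f) nat.
  move=> rn; apply: ncn; rewrite /Defs.card_leT -(card_le_eql rc).
  by move: rn; rewrite /Defs.card_leT (card_le_eql (card_setT _)).
have := Amin (exist uncountable _ rI); rewrite /= /Defs.card_leT.
by rewrite (card_le_eqr (card_setT _)) (card_le_eqr rc).
Qed.

Lemma is_succ_card_eq (a a' b : Type) : [set: a] #= [set: a'] ->
  is_succ_card a b -> is_succ_card a' b.
Proof.
move=> aa' [[ab nba] bmin]; split.
  split; first by rewrite /Defs.card_leT -(card_le_eql aa').
  by rewrite /Defs.card_leT -(card_le_eqr aa').
move=> c [ac nca]; apply: bmin; split.
  by rewrite /Defs.card_leT (card_le_eql aa').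
by rewrite /Defs.card_leT (card_le_eqr aa').
Qed.

Lemma succ_card_II n : is_succ_card `I_n `I_n.+1.
Proof.
split; first by split; rewrite card_leTE card_le_II ?ltnn.
move=> c [nc ncn]; rewrite /Defs.card_leT (card_le_eql (card_setT _)).
have [[m cm]|/infiniteP] := pselect (finite_set [set: c]); last first.
  by apply: card_le_trans; exact: card_leT.
rewrite (card_le_eqr cm) card_le_II.
move: ncn; rewrite /Defs.card_leT (card_le_eql cm) (card_le_eqr (card_setT _)).
by rewrite card_le_II ltnNge => /negP.
Qed.

(** * Order at most omega and point-finiteness *)

Section point_finite_order.
Context {T : Type}.
Implicit Types E D : set (set T).

Let point_finite E := forall x : T, finite_set [set A | E A /\ A x].

(** Infinitely many members through a point would include a countably infinite subcollection, whose
    successor, an uncountable cardinal, would be at most the order. *)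
Lemma ord_le_nat_finite E : ord_le E nat -> point_finite E.
Proof.
move=> [b [[n [_ Emax] _]|[_ [bub _]]] bn] x.
  apply/finite_set_leP; exists n; apply: Emax.
  by split=> [A []//|]; exists x => A [].
apply: contrapT => /infiniteP/card_subP[D Dnat DE].
have [c cS] := succ_card_nat.
have [|[_ +] _] := is_succ_card_eq (a' := D) _ cS.
  by apply: card_esym; apply: card_eq_trans (card_setT _) Dnat.
apply; rewrite /Defs.card_leT (card_le_eqr (card_setT _)) (card_le_eqr Dnat).
apply: card_le_trans bn; apply: bub; exists D.
  by split=> [A /DE[]//|]; exists x => A /DE[].
apply: is_succ_card_eq cS; apply: card_esym.
exact: card_eq_trans (card_setT _) Dnat.
Qed.

(** Intersecting subcollections are finite. If their sizes are bounded, the maximum exists;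
    otherwise the supremum of the successors of their sizes is omega. *)
Lemma finite_ord_le_nat (x0 : T) E : point_finite E -> ord_le E nat.
Proof.
move=> Efin.
have Dfin D : intersecting_in E D -> finite_set D.
  move=> [DE [x xD]]; apply: sub_finite_set (Efin x) => A DA.
  by split; [exact: DE|exact: xD].
have [[n nmax]|nomax] := pselect (exists n, is_max_intersecting E n).
  exists `I_n; first by left; exists n => //; exact: card_setT.
  by rewrite /Defs.card_leT (card_le_eql (card_setT _)); exact: card_leT.
exists nat; last exact: card_lexx.
right; split=> //; split.
  move=> b [D DE [_ bmin]]; apply: bmin.
  have [n Dn] := Dfin _ DE; split.
    rewrite /Defs.card_leT (card_le_eql (card_setT _)) (card_le_eql Dn).
    exact: card_leT.
  rewrite /Defs.card_leT (card_le_eqr (card_setT _)).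
  by apply/finite_setPn; exact: Dfin.
move=> c cub; apply/infiniteP => -[m cm].
have [D DE Dm] : exists2 D, intersecting_in E D & ~ (D #<= `I_m).
  apply: contrapT => h; apply: nomax.
  have bnd D : intersecting_in E D -> D #<= `I_m.
    by move=> DE; apply: contrapT => Dm; apply: h; exists D.
  pose p n := `[< exists2 D, intersecting_in E D & D #= `I_n >].
  have p0 : exists n, p n.
    (* The empty subcollection has intersection [T], which contains [x0]; so some size is
       attained. *)
    exists 0%N; apply/asboolP; exists set0; last by rewrite II0; exact: card_eq00.
    by split=> //; exists x0.
  have pm n : p n -> (n <= m)%N.
    by move=> /asboolP[D /bnd + Dn]; rewrite (card_le_eql Dn) card_le_II.
  case: (ex_maxnP p0 pm) => n /asboolP pn nmax; exists n; split=> // D DE.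
  have [k Dk] := Dfin _ DE; rewrite (card_le_eql Dk) card_le_II; apply: nmax.
  by apply/asboolP; exists D.
have [k Dk] := Dfin _ DE.
have kc : Defs.card_leT `I_k.+1 c.
  apply: cub; exists D => //; apply: is_succ_card_eq (succ_card_II k).
  apply: (card_eq_trans (card_setT _)); apply: card_esym.
  exact: (card_eq_trans (card_setT _)).
apply: Dm; rewrite (card_le_eql Dk) card_le_II.
move: kc; rewrite /Defs.card_leT (card_le_eql (card_setT _)) (card_le_eqr cm).
rewrite card_le_II.
exact: ltnW.
Qed.

End point_finite_order.

Lemma rpc_le_stone {K : numFieldType} (M : metricType K) :
  rpc_le M nat -> uniform_stone M.
Proof.
move=> [b [bref _] bn] U Ucov; have [V [Vcov VU Vord]] := bref U Ucov.
exists V; split=> //; apply: ord_le_nat_finite.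
by case: Vord => a aE ab; exists a => //; exact: card_le_trans ab bn.
Qed.

(** Besides the bound, the least cardinal has to be exhibited: it is the smallest natural number
    that works, or [nat] if none does. *)
Lemma stone_rpc_le {K : numFieldType} (M : metricType K) (x0 : M) :
  uniform_stone M -> rpc_le M nat.
Proof.
move=> stone.
have ref_nat : has_refinements_of_ord M nat.
  move=> U /stone[V [Vcov Vfin VU]]; exists V; split=> //.
  exact: finite_ord_le_nat.
have ref_mono a b : Defs.card_leT a b ->
    has_refinements_of_ord M a -> has_refinements_of_ord M b.
  move=> ab aref U /aref[V [Vcov VU [c cV ca]]]; exists V; split=> //.
  by exists c => //; exact: card_le_trans ca ab.
have [[n nref]|noref] := pselect (exists n, has_refinements_of_ord M `I_n).
  pose p n := `[< has_refinements_of_ord M `I_n >].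
  have pex : exists n, p n by exists n; exact/asboolP.
  case: (ex_minnP pex) => m /asboolP mref mmin; exists `I_m.
    split=> // b bref.
    rewrite /Defs.card_leT (card_le_eql (card_setT _)).
    have [[k bk]|/infiniteP] := pselect (finite_set [set: b]); last first.
      by apply: card_le_trans; exact: card_leT.
    rewrite (card_le_eqr bk) card_le_II; apply: mmin; apply/asboolP.
    apply: ref_mono bref; rewrite /Defs.card_leT (card_le_eql bk).
    by rewrite (card_le_eqr (card_setT _)); exact: card_lexx.
  by rewrite /Defs.card_leT (card_le_eql (card_setT _)); exact: card_leT.
exists nat; last exact: card_lexx.
split=> // b bref; apply/infiniteP => -[k bk]; apply: noref; exists k.
apply: ref_mono bref; rewrite /Defs.card_leT (card_le_eql bk).
by rewrite (card_le_eqr (card_setT _)); exact: card_lexx.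
Qed.

(** * Scalars *)

(* The field [lattice] abstracts the integers in R and the Gaussian integers
   in R[i]. *)
Record real_scalars (R : realType) (K : numFieldType) := RealScalars {
  real_inj : {rmorphism R -> K};
  real_inj_le : {mono real_inj : x y / x <= y};
  real_inj_onto : forall z, z \is Num.real -> exists r, z = real_inj r;
  lattice : set K;
  lattice_near : forall z, exists2 l, lattice l & `|z - l| <= real_inj (3 / 4);
  lattice_discrete : forall l, lattice l -> `|l| < 1 -> l = 0;
  lattice_finite : forall z, finite_set [set l | lattice l /\ `|z - l| < 1]
}.

Lemma int_near (R : realType) (x : R) : exists k : int, `|x - k%:~R| <= 1 / 2.
Proof.
exists (Num.floor (x + 1 / 2)).
have /andP[h1 h2] := floor_itv (x + 1 / 2).
rewrite ler_norml; move: h1 h2; rewrite intrD /=; lra.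
Qed.

Lemma int_near_finite (R : realType) (x : R) :
  finite_set [set k : int | `|x - k%:~R| < 1].
Proof.
apply: (@sub_finite_set _ _ [set Num.floor x; Num.floor x + 1]);
  last exact: finite_set2.
move=> k /=; rewrite ltr_norml => /andP[h1 h2].
have /andP[h3 h4] := floor_itv x.
have h5 : Num.floor x < k + 1 by rewrite -(ltr_int R) intrD /=; lra.
have h6 : k < Num.floor x + 1 + 1.
  by rewrite -(ltr_int R); move: h4; rewrite !intrD /=; lra.
move: h5 h6; rewrite !ltzD1 => h5; rewrite le_eqVlt => /orP[/eqP->|].
  by right.
by rewrite ltzD1 => h6; left; apply/eqP; rewrite eq_le h5 h6.
Qed.

Lemma int_discrete (R : realType) (k : int) : `|k%:~R : R| < 1 -> k = 0.
Proof.
by rewrite -intr_norm (_ : 1 = 1%:~R)// ltr_int; case: k => [[|n]|n].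
Qed.

Lemma real_scalars_real (R : realType) : inhabited (real_scalars R R).
Proof.
apply: inhabits.
apply: (@RealScalars R R idfun _ _ (range (fun k : int => k%:~R))).
- by [].
- by move=> z _; exists z.
- move=> z; have [k zk] := int_near z; exists k%:~R; first by exists k.
  by apply: (le_trans zk) => /=; lra.
- by move=> _ [k _ <-] /int_discrete->.
- move=> z; apply: sub_finite_set (finite_image (fun k : int => k%:~R)
    (int_near_finite z)).
  by move=> _ [[k _ <-] zk]; exists k.
Qed.

Lemma real_scalars_complex (R : realType) : inhabited (real_scalars R R[i]).
Proof.
pose gauss (kl : int * int) : R[i] := (kl.1%:~R +i* kl.2%:~R)%C.
have normcE (a b : R) : `|(a +i* b)%C| = (Num.sqrt (a ^+ 2 + b ^+ 2))%:C%C.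
  by rewrite normc_def.
have sqrt_lt (a b c : R) : 0 <= c -> `|(a +i* b)%C| < (c%:C)%C ->
    `|a| < c /\ `|b| < c.
  move=> c0; rewrite normcE ltcR => abc.
  have a2 : 0 <= a ^+ 2 by exact: sqr_ge0.
  have b2 : 0 <= b ^+ 2 by exact: sqr_ge0.
  by split; apply: le_lt_trans abc;
    rewrite -sqrtr_sqr ler_sqrt ?addr_ge0// ?lerDl ?lerDr.
apply: inhabits.
apply: (@RealScalars R R[i] (real_complex R) _ _ (range gauss)).
- exact: lecR.
- by move=> [a b]; rewrite complex_real => /eqP /= b0; exists a; rewrite b0.
(* Rounding both coordinates gives an error of at most the square root of [1/2], which is below
   [3/4]; the squares are compared. *)
- move=> [a b]; have [k ak] := int_near a; have [l bl] := int_near b.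
  exists (gauss (k, l)); first by exists (k, l).
  rewrite [(_ - _)%C](_ : _ = ((a - k%:~R) +i* (b - l%:~R))%C)//.
  rewrite normcE lecR -(ler_pXn2r (n := 2)) ?nnegrE ?sqrtr_ge0//.
  rewrite sqr_sqrtr ?addr_ge0 ?sqr_ge0//.
  rewrite -(real_normK (num_real (a - _))) -(real_normK (num_real (b - _))).
  have := ler_pM (normr_ge0 _) (normr_ge0 _) ak ak.
  have := ler_pM (normr_ge0 _) (normr_ge0 _) bl bl.
  rewrite -!expr2; lra.
- move=> _ [[k l] _ <-] kl.
  have [] := sqrt_lt _ _ 1 ler01 kl.
  by rewrite /gauss /= => /int_discrete-> /int_discrete->.
- move=> [a b].
  apply: sub_finite_set (finite_image gauss
    (finite_setX (int_near_finite a) (int_near_finite b))).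
  move=> _ [[[k l] _ <-] /(sqrt_lt _ _ 1 ler01)] /= kl; by exists (k, l).
Qed.

Lemma real_or_complex_scalars (R : realType) (K : numFieldType) :
  real_or_complex R K -> inhabited (real_scalars R K).
Proof. by case=> ->; [exact: real_scalars_real|exact: real_scalars_complex]. Qed.

(** * Point-finite covers with a Lebesgue number *)

(* Distances in K are real, so the default value 0 is never taken. *)
Definition rdist {R : realType} {K : numFieldType} (S : real_scalars R K)
  {M : metricType K} (x y : M) : R := xget 0 [set r | mdist x y = real_inj S r].

Section real_distance.
Context {R : realType} {K : numFieldType} (S : real_scalars R K).
Local Notation iota := (real_inj S).
Local Notation rd := (rdist S).

Lemma real_inj_lt : {mono iota : x y / x < y}.
Proof. exact: leW_mono (real_inj_le S). Qed.

Lemma real_inj_norm r : `|iota r| = iota `|r|.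
Proof.
have [r0|/ltW r0] := leP 0 r.
  by rewrite (ger0_norm r0) ger0_norm// -(rmorph0 iota) real_inj_le.
by rewrite (ler0_norm r0) ler0_norm ?rmorphN// -(rmorph0 iota) real_inj_le.
Qed.

Lemma real_inj_pos e : 0 < e -> exists2 r, 0 < r & e = iota r.
Proof.
move=> e0; have [r re] := real_inj_onto S (gtr0_real e0).
by exists r => //; rewrite -real_inj_lt rmorph0 -re.
Qed.

Lemma real_inj_nneg e : 0 <= e -> exists2 r, 0 <= r & e = iota r.
Proof.
move=> e0; have [r re] := real_inj_onto S (ger0_real e0).
by exists r => //; rewrite -(real_inj_le S) rmorph0 -re.
Qed.

Lemma real_inj_gt0 r : (0 < iota r) = (0 < r).
Proof. by rewrite -(rmorph0 iota) real_inj_lt. Qed.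

Lemma real_inj_ge0 r : (0 <= iota r) = (0 <= r).
Proof. by rewrite -(rmorph0 iota) real_inj_le. Qed.

Section metric.
Context {M : metricType K}.
Implicit Types (x y z : M) (E F : set M).

Lemma rdistE x y : mdist x y = iota (rd x y).
Proof.
have [r xyr] := real_inj_onto S (ger0_real (mdist_ge0 x y)).
exact: (@xgetPex _ 0 [set r | mdist x y = iota r] (ex_intro _ r xyr)).
Qed.

Lemma rdist_ge0 x y : 0 <= rd x y.
Proof. by rewrite -real_inj_ge0 -rdistE mdist_ge0. Qed.

Lemma rdistxx x : rd x x = 0.
Proof. by apply: (fmorph_inj iota); rewrite -rdistE mdist_self rmorph0. Qed.

Lemma rdist_eq0 x y : rd x y = 0 -> x = y.
Proof. by move=> xy; apply: mdist_positivity; rewrite rdistE xy rmorph0. Qed.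

Lemma rdistC x y : rd x y = rd y x.
Proof. by apply: (fmorph_inj iota); rewrite -!rdistE mdistC. Qed.

Lemma rdist_trg y x z : rd x z <= rd x y + rd y z.
Proof. by rewrite -(real_inj_le S) rmorphD -!rdistE mdist_trg. Qed.

Lemma ball_rdist x r : ball x (iota r) = [set y | rd x y < r].
Proof.
by rewrite ballEmdist; apply/seteqP; split=> y /=; rewrite rdistE real_inj_lt.
Qed.

End metric.

Lemma rdist_subspace {M : metricType K} (A : set M) (u v : metric_subspace A) :
  rd u v = rd (set_val u) (set_val v).
Proof. by apply: (fmorph_inj iota); rewrite -!rdistE. Qed.

(* Point-finite families of diameter at most D and, on E, Lebesgue number s. *)
Definition covered_on {M : metricType K} (E : set M) (s D : R) :=
  exists V : set (set M), [/\ point_finite V,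
    forall x, E x -> exists2 A, V A & forall y, E y -> rd x y < s -> A y &
    forall A x y, V A -> A x -> A y -> rd x y <= D].

(** Restriction, rescaling and embeddings all transfer covers in this way: Lebesgue numbers through
    an upper bound on the distances of images, diameters through a lower one. *)
Lemma covered_on_pullback (M N : metricType K) (f : M -> N) E F s s' D D' :
  (forall x, E x -> F (f x)) ->
  (forall x y, E x -> E y -> rd x y < s' -> rd (f x) (f y) < s) ->
  (forall x y, E x -> E y -> rd (f x) (f y) <= D -> rd x y <= D') ->
  covered_on F s D -> covered_on E s' D'.
Proof.
move=> fEF fs fD [V [Vfin Vleb Vdiam]].
exists [set E `&` f @^-1` A | A in V]; split.
- move=> x; apply: sub_finite_set (finite_image (fun A => E `&` f @^-1` A)
    (Vfin (f x))).
  by move=> _ [[A VA <-] [Ex Afx]]; exists A.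
- move=> x Ex; have [A VA xA] := Vleb _ (fEF _ Ex).
  exists (E `&` f @^-1` A); first by exists A.
  by move=> y Ey xy; split=> //; apply: xA; [exact: fEF|exact: fs].
- move=> _ x y [A VA <-] [Ex Ax] [Ey Ay]; apply: fD => //; exact: Vdiam Ax Ay.
Qed.

Lemma covered_on_weak (M : metricType K) (E F : set M) s s' D D' :
  E `<=` F -> s' <= s -> D <= D' -> covered_on F s D -> covered_on E s' D'.
Proof.
move=> EF ss DD; apply: (@covered_on_pullback _ _ id) =>
  [x /EF//|x y _ _ h|x y _ _ h].
  exact: lt_le_trans ss.
exact: le_trans DD.
Qed.

(** Each member [A] of the first family is split by its own family [W A]. Cutting the pieces down to
    [A] keeps point-finiteness: a point meets only the families of the finitely many [A] containing
    it. *)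
Lemma covered_on_compose (M : metricType K) (E : set M) s D s' D' : 0 < s ->
  covered_on E s D ->
  (forall F : set M, (forall x y, F x -> F y -> rd x y <= D) ->
    covered_on F s' D') ->
  covered_on E (Num.min s s') D'.
Proof.
move=> s0 [V [Vfin Vleb Vdiam]] Dcov.
have /choice[W WP] : forall A, exists W, V A -> [/\ point_finite W,
    forall x, A x -> exists2 B, W B & forall y, A y -> rd x y < s' -> B y &
    forall B x y, W B -> B x -> B y -> rd x y <= D'].
  move=> A; have [VA|nVA] := pselect (V A); last by exists set0.
  by have [x y|W WP] := Dcov A _; [exact: Vdiam|exists W].
exists [set C | exists A B, [/\ V A, W A B & C = A `&` B]]; split.
- move=> x; pose Vx := [set A | V A /\ A x].
  apply: (@sub_finite_set _ _ (\bigcup_(A in Vx)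
      [set A `&` B | B in [set B | W A B /\ B x]])).
    by move=> _ [[A [B [VA WAB ->]]] [Ax Bx]]; exists A => //; exists B.
  apply: bigcup_finite; first exact: Vfin.
  by move=> A [VA _]; apply: finite_image; have [+ _ _] := WP _ VA; apply.
- move=> x Ex; have [A VA xA] := Vleb x Ex.
  have [_ Wleb _] := WP _ VA.
  have Ax : A x by apply: xA => //; rewrite rdistxx.
  have [B WB xB] := Wleb x Ax.
  exists (A `&` B); first by exists A, B.
  move=> y Ey; rewrite lt_min => /andP[xys xys'].
  by have Ay := xA _ Ey xys; split=> //; exact: xB.
- move=> _ x y [A [B [VA WAB ->]]] [_ Bx] [_ By].
  by have [_ _ Wd] := WP _ VA; apply: Wd Bx By.
Qed.

(* The family for the n-th ball is used only at the points x for which n is the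
   least integer above rd x0 x + s, and near them. *)
Lemma covered_on_glue (M : metricType K) (x0 : M) s D : 0 < s ->
  (forall n : nat, covered_on [set x : M | rd x0 x <= n%:R] s D) ->
  covered_on [set: M] s D.
Proof.
move=> s0 /choice[V VP].
(* Each point lies in [G n] for finitely many [n] only. The second [s] is a margin: if [n] is the
   least integer above [rd x0 x + s], then [G n] contains the whole [s]-ball about [x]. *)
pose G n := [set y | forall j : nat, rd x0 y + s + s <= j%:R -> (n <= j)%N].
have archi x : exists j : nat, x <= j%:R :> R.
  by exists (Num.bound `|x|); rewrite (le_trans (ler_norm x))// ltW// archi_boundP.
exists [set C | exists n A, V n A /\ C = A `&` G n]; split.
- move=> y; have [j yj] := archi (rd x0 y + s + s).
  apply: (@sub_finite_set _ _ (\bigcup_(n in `I_j.+1)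
      [set A `&` G n | A in [set A | V n A /\ A y]])).
    by move=> _ [[n [A [VA ->]]] [Ay /(_ _ yj)]] nj; exists n => //; exists A.
  apply: bigcup_finite; first exact: finite_II.
  by move=> n _; apply: finite_image; have [+ _ _] := VP n; apply.
- move=> x _; pose p n := rd x0 x + s <= n%:R.
  have pex : exists n, p n := archi _.
  case: (ex_minnP pex) => n pn nmin.
  have [_ Vleb _] := VP n.
  have [|A VA xA] := Vleb x; first by apply: le_trans pn; rewrite /=; lra.
  exists (A `&` G n); first by exists n, A.
  move=> y _ xy; split.
    apply: xA => //=; move: pn; rewrite /p.
    have := rdist_trg x x0 y; lra.
  move=> j yj; apply: nmin; rewrite /p; have := rdist_trg y x0 x.
  rewrite (rdistC y x); lra.
- move=> _ x y [n [A [VA ->]]] [Ax _] [Ay _].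
  by have [_ _] := VP n; apply; eassumption.
Qed.

(** * Lebesgue numbers and the two Stone properties *)

Section covers_and_stone.
Context {M : metricType K}.

Lemma stone_covered_on D : uniform_stone M -> 0 < D ->
  exists2 s, 0 < s & covered_on [set: M] s D.
Proof.
move=> stone D0.
have D20 : 0 < D / 2 by lra.
have [|V [[Vcov [e e0 eV]] Vfin VU]] :=
  stone [set ball x (iota (D / 2)) | x in [set: M]].
  split; last by exists (iota (D / 2));
    [rewrite real_inj_gt0|move=> A UA; exists A].
  apply/seteqP; split=> // x _; exists (ball x (iota (D / 2))); first by exists x.
  by rewrite ball_rdist /= rdistxx.
have [s s0 es] := real_inj_pos e0; exists s => //; exists V; split=> //.
  move=> x _; have [|A VA xA] := eV (ball x e); first by exists x.
  exists A => // y _ xy; apply: xA; by rewrite es ball_rdist.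
move=> A x y VA Ax Ay; have [_ [z _ <-]] := VU A VA.
rewrite ball_rdist => /[dup] /(_ _ Ax) /= zx /(_ _ Ay) /= zy.
by have := rdist_trg z x y; rewrite (rdistC x z); lra.
Qed.

Lemma covered_on_stone :
  (forall D, 0 < D -> exists2 s, 0 < s & covered_on [set: M] s D) ->
  uniform_stone M.
Proof.
move=> Mcov U [Ucov [e e0 eU]]; have [r r0 er] := real_inj_pos e0.
have [|s s0 [V [Vfin Vleb Vdiam]]] := Mcov (r / 2); first by lra.
(* Empty members are dropped, since a member is placed inside a set of [U] through one of its
   points. *)
exists [set A | V A /\ A !=set0]; split.
- have leb x : exists2 A, V A /\ A !=set0 & ball x (iota s) `<=` A.
    have [//|A VA xA] := Vleb x; exists A; last by rewrite ball_rdist => y; exact: xA.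
    by split=> //; exists x; apply: xA => //; rewrite rdistxx.
  split; last by exists (iota s);
    [rewrite real_inj_gt0|move=> _ [x _ <-]; exact: leb].
  apply/seteqP; split=> // x _; have [A VA xA] := leb x; exists A => //.
  apply: xA.
  by rewrite ball_rdist /= rdistxx.
- move=> x; apply: sub_finite_set (Vfin x); by move=> A [[]].
- move=> A [VA [x Ax]]; have [|B UB xB] := eU (ball x e); first by exists x.
  exists B => // y Ay; apply: xB; rewrite er ball_rdist /=.
  by have := Vdiam _ _ _ VA Ax Ay; lra.
Qed.

Lemma coarse_stone_covered_on : coarse_stone M ->
  exists2 D, 0 < D & covered_on [set: M] 1 D.
Proof.
move=> stone.
have [||V [Vcov [e e0 eV] Vfin UV]] := stone [set ball x 1 | x in [set: M]].
- apply/seteqP; split=> // x _; exists (ball x 1); first by exists x.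
  by rewrite -(rmorph1 iota) ball_rdist /= rdistxx.
- exists (iota 2); first by rewrite real_inj_gt0.
  move=> _ [z _ <-] _ [[x y] [/= zx zy] <-] /=.
  move: zx zy; rewrite -(rmorph1 iota) !ball_rdist /= => zx zy.
  rewrite rdistE real_inj_le; have := rdist_trg z x y; rewrite (rdistC x z); lra.
have [D D0 eD] := real_inj_pos e0; exists D => //; exists V; split=> //.
  move=> x _; have [|A VA xA] := UV (ball x 1); first by exists x.
  by exists A => // y _ xy; apply: xA; rewrite -(rmorph1 iota) ball_rdist.
move=> A x y VA Ax Ay; rewrite -(real_inj_le S) -eD -rdistE.
by apply: (eV A VA); exists (x, y).
Qed.

Lemma covered_on_coarse_stone (x0 : M) :
  (forall s, 0 < s -> exists D, covered_on [set: M] s D) -> coarse_stone M.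
Proof.
move=> Mcov U Ucov [e e0 eU]; have [r r0 er] := real_inj_pos e0.
have [|D [V [Vfin Vleb Vdiam]]] := Mcov (r + 1); first by lra.
exists V; split=> //.
- apply/seteqP; split=> // x _; have [//|A VA xA] := Vleb x.
  by exists A => //; apply: xA => //; rewrite rdistxx; lra.
- exists (iota (`|D| + 1)); first by rewrite real_inj_gt0 ltr_wpDl.
  move=> A VA _ [[x y] [/= Ax Ay] <-]; rewrite rdistE real_inj_le.
  by have := Vdiam _ _ _ VA Ax Ay; have := ler_norm D; lra.
(* An empty [A] lies in any member of [V], and [x0] provides one. *)
- move=> A UA; have [[x Ax]|A0] := pselect (A !=set0); last first.
    have [//|B VB _] := Vleb x0; exists B => // y Ay; by case: A0; exists y.
  have [//|B VB xB] := Vleb x; exists B => // y Ay; apply: xB => //.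
  have : mdist x y <= e by apply: (eU A UA); exists (x, y).
  by rewrite er rdistE real_inj_le; lra.
Qed.

End covers_and_stone.

(** * Transfer of covers along embeddings *)

Section embedded.
Context {M N : metricType K}.

Lemma uniform_embedding_covered_on (f : M -> N) : uniform_embedding f ->
  (forall D, 0 < D -> exists2 s, 0 < s & covered_on [set: N] s D) ->
  forall D, 0 < D -> exists2 s, 0 < s & covered_on [set: M] s D.
Proof.
move=> [f_inj /unif_continuousP f_unif [g gf /unif_continuousP g_unif]] Ncov D D0.
have [|e e0 ge] := g_unif (iota (D / 2)); first by rewrite /= real_inj_gt0; lra.
have [r r0 er] := real_inj_pos e0.
have [|s s0 Ns] := Ncov (r / 2); first by lra.
have [|e' e'0 fe] := f_unif (iota s); first by rewrite /= real_inj_gt0.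
have [s' s'0 es'] := real_inj_pos e'0.
exists s' => //; apply: covered_on_pullback Ns => // [x y _ _ xy|x y _ _ xy].
  by have := fe (x, y); rewrite /= es' !ball_rdist; apply.
pose u z : metric_subspace (range f) := SigSub (mem_set (imageT f z)).
have gu z : g (u z) = z by apply: f_inj; rewrite gf.
have := ge (u x, u y); rewrite /= er !ball_rdist /= !gu rdist_subspace /=.
move=> h; suff : rd x y < D / 2 by lra.
by apply: h; lra.
Qed.

Lemma coarse_embedding_covered_on (f : M -> N) : coarse_embedding f ->
  (forall s, 0 < s -> exists D, covered_on [set: N] s D) ->
  exists2 D, 0 < D & covered_on [set: M] 1 D.
Proof.
move=> [f_up f_low] Ncov.
have [k /real_inj_nneg[r r0 ->] fk] := f_up 1 ltr01.
have [|D Ns] := Ncov (r + 1); first by lra.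
(* [|D| + 1] is positive and exceeds [D], whatever the sign of [D]. *)
have [|e e0 fe] := f_low (iota (`|D| + 1)); first by rewrite real_inj_gt0 ltr_wpDl.
have [d d0 ed] := real_inj_pos e0.
exists d => //; apply: covered_on_pullback Ns => // [x y _ _ xy|x y _ _ xy].
  have := fk x y; rewrite !rdistE -(rmorph1 iota) !real_inj_le => h.
  by have := h (ltW xy); lra.
rewrite leNgt; apply/negP => dxy.
have := fe x y; rewrite ed !rdistE !real_inj_le => /(_ (ltW dxy)).
by have := ler_norm D; lra.
Qed.

Lemma bilipschitz_uniform (f : M -> N) :
  bilipschitz_embedding f -> uniform_embedding f.
Proof.
have lip_unif (A B : metricType K) (h : A -> B) :
    lipschitz_map h -> unif_continuous h.
  move=> [L /real_inj_nneg[l l0 ->] hl]; apply/unif_continuousP => e /= e0.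
  have [r r0 ->] := real_inj_pos e0.
  exists (iota (r / (l + 1))); first by rewrite /= real_inj_gt0 divr_gt0//; lra.
  move=> [x y]; rewrite !ball_rdist /= => xy.
  have := hl x y; rewrite !rdistE -rmorphM real_inj_le => /le_lt_trans; apply.
  move: xy; rewrite ltr_pdivlMr; last by lra.
  by have := rdist_ge0 x y; nra.
move=> [f_inj f_lip [g gf g_lip]]; split=> //; first exact: lip_unif.
by exists g => //; exact: lip_unif.
Qed.

Lemma bilipschitz_coarse (f : M -> N) :
  bilipschitz_embedding f -> coarse_embedding f.
Proof.
move=> [f_inj [L /real_inj_nneg[l l0 ->] fl]
  [g gf [L' /real_inj_nneg[l' l'0 ->] gl]]].
split=> [d /real_inj_pos[r r0 ->]|k /real_inj_pos[r r0 ->]].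
  exists (iota (l * r)); first by rewrite real_inj_ge0 mulr_ge0// ltW.
  move=> x y; rewrite !rdistE !real_inj_le => xy.
  have := fl x y; rewrite !rdistE -rmorphM real_inj_le => /le_trans; apply.
  by rewrite ler_wpM2l.
(* [l' + 1] keeps the threshold positive when [l'] is 0. *)
exists (iota ((l' + 1) * r)); first by rewrite real_inj_gt0 mulr_gt0//; lra.
move=> x y; rewrite !rdistE !real_inj_le => xy.
pose u z : metric_subspace (range f) := SigSub (mem_set (imageT f z)).
have gu z : g (u z) = z by apply: f_inj; rewrite gf.
have := gl (u x) (u y); rewrite !gu !rdistE -rmorphM real_inj_le rdist_subspace /=.
have := rdist_ge0 (f x) (f y); nra.
Qed.

Lemma bilipschitz_of_bounds (f : M -> N) (l l' : R) : 0 <= l -> 0 <= l' ->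
  (forall x y, rd (f x) (f y) <= l * rd x y) ->
  (forall x y, rd x y <= l' * rd (f x) (f y)) -> bilipschitz_embedding f.
Proof.
move=> l0 l'0 fl fl'; split.
- move=> x y fxy; apply: rdist_eq0; apply/eqP; rewrite eq_le rdist_ge0 andbT.
  by rewrite (le_trans (fl' x y))// fxy rdistxx mulr0.
- exists (iota l); first by rewrite real_inj_ge0.
  by move=> x y; rewrite !rdistE -rmorphM real_inj_le.
have /choice[g gf] : forall u : metric_subspace (range f),
    exists x, f x = set_val u.
  by move=> u; have /set_mem[x _ fx] := valP u; exists x.
exists g => //; exists (iota l'); first by rewrite real_inj_ge0.
move=> u v; rewrite !rdistE -rmorphM real_inj_le rdist_subspace -!gf; exact: fl'.
Qed.

End embedded.

Lemma bilipschitz_subspace {M N : metricType K} (A : set M) (f : M -> N) :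
  bilipschitz_embedding f ->
  bilipschitz_embedding (fun u : metric_subspace A => f (set_val u)).
Proof.
move=> [f_inj [L /real_inj_nneg[l l0 ->] fl]
  [g gf [L' /real_inj_nneg[l' l'0 ->] gl]]].
apply: (bilipschitz_of_bounds l0 l'0) => u v; rewrite rdist_subspace.
  by rewrite -(real_inj_le S) rmorphM -!rdistE.
pose w z : metric_subspace (range f) := SigSub (mem_set (imageT f z)).
have gw z : g (w z) = z by apply: f_inj; rewrite gf.
rewrite -(real_inj_le S) rmorphM -!rdistE.
by have := gl (w (set_val u)) (w (set_val v)); rewrite !gw.
Qed.

End real_distance.

(** * Normed spaces and c0 *)

(** This will count the boxes containing a point of c0: off a finite set of coordinates their
    centres are forced to be 0. *)
Lemma finite_set_functions (G T : Type) (z : T) (F : G -> set T) (s : set G) :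
  finite_set s -> (forall g, finite_set (F g)) ->
  finite_set [set k : G -> T | forall g, (s g -> F g (k g)) /\ (~ s g -> k g = z)].
Proof.
elim/Pchoice: G => G in F s *.
move=> /finite_seqP[l ->] Ffin.
elim: l => [|a l ih].
  apply: (@sub_finite_set _ _ [set (fun=> z)]); last exact: finite_set1.
  by move=> k /= kP; apply/funext => g; apply: (kP g).2.
(* A function equal to [z] off [a :: l] is recovered from its values on [l] and its value at [a]. *)
pose upd (k : G -> T) v := fun g => if g == a then v else k g.
apply: sub_finite_set (finite_image2 upd ih (Ffin a)) => k kP.
exists (fun g => if g \in l then k g else z).
  by move=> g; split=> /= gl; [rewrite gl; apply: (kP g).1; rewrite /= inE gl orbT
    |rewrite ifN//; exact/negP].
exists (k a); first by apply: (kP a).1; rewrite /= mem_head.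
apply/funext => g; rewrite /upd; case: eqP => [->//|/eqP ga].
case: ifPn => // gl; apply/esym/(kP g).2.
by move=> /=; rewrite inE (negbTE ga) (negbTE gl).
Qed.

Section c0_distance.
Context {R : realType} {K : numFieldType} (S : real_scalars R K) {Gamma : Type}.
Local Notation iota := (real_inj S).
Local Notation rd := (rdist S).
Implicit Types x y : c0 K Gamma.

Lemma c0_rdist_ge x y g : `|\val y g - \val x g| <= iota (rd x y).
Proof. rewrite -rdistE; exact: (c0_norm_ge (y - x) g). Qed.

Lemma c0_rdist_le x y r : 0 <= r ->
  (forall g, `|\val y g - \val x g| <= iota r) -> rd x y <= r.
Proof.
move=> r0 xyr; rewrite -(real_inj_le S) -rdistE.
have [[g _]|G0] := pselect (exists g : Gamma, True).
  by have [g1 e _] := c0_norm_max (y - x) g; rewrite [leLHS]e; exact: xyr.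
rewrite [leLHS](@c0_norm_empty K Gamma (y - x)) ?real_inj_ge0// => g.
by apply: G0; exists g.
Qed.

End c0_distance.

Section normed.
Context {R : realType} {K : numFieldType} (S : real_scalars R K).
Context {X : normedModType K}.
Local Notation iota := (real_inj S).
Local Notation rd := (rdist S).
Local Notation covered_on := (covered_on S).

Lemma rdist_scale (a x y : X) c : 0 <= c ->
  rd (iota c *: (x - a)) (iota c *: (y - a)) = c * rd x y.
Proof.
move=> c0; apply: (fmorph_inj iota); rewrite rmorphM -!rdistE.
rewrite {1}[mdist _ _](_ : _ = `|iota c *: (y - a) - iota c *: (x - a)|)//.
rewrite -scalerBr normrZ ger0_norm ?real_inj_ge0//; congr (_ * _).
by rewrite opprB addrA subrK.
Qed.

Lemma covered_on_scale (a : X) (E F : set X) c s D : 0 < c ->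
  (forall x, E x -> F (iota c *: (x - a))) ->
  covered_on F s D -> covered_on E (s / c) (D / c).
Proof.
move=> c0 EF; apply: covered_on_pullback EF _ _ => x y _ _.
  by rewrite rdist_scale ?(ltW c0)// ltr_pdivlMr// mulrC.
by rewrite rdist_scale ?(ltW c0)// ler_pdivlMr// mulrC.
Qed.

End normed.

(** * Self-improvement by repeated halving *)

Section halving.
Context {R : realType} {K : numFieldType} (S : real_scalars R K).
Local Notation iota := (real_inj S).
Local Notation rd := (rdist S).
Local Notation covered_on := (covered_on S).

Definition halvable (M : metricType K) := exists2 s0 : R, 0 < s0 &
  forall D (F : set M), 0 < D -> (forall x y, F x -> F y -> rd x y <= D) ->
  covered_on F (D * s0) (D / 2).

(* Splitting k times the pieces of a bounded set keeps the ratio of the Lebesgue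
   number to the diameter. *)
Lemma halvable_covered_on (M : metricType K) (x0 : M) : halvable M ->
  exists2 C, 0 < C & forall s, 0 < s -> covered_on [set: M] s (C * s).
Proof.
move=> [s0 s00 base].
have pow2 k : 0 < 2 ^+ k :> R by rewrite exprn_gt0.
have iter k : forall D (F : set M), 0 < D ->
    (forall x y, F x -> F y -> rd x y <= D) ->
    covered_on F (D * s0 / 2 ^+ k) (D / 2 ^+ k.+1).
  elim: k => [|k ih] D F D0 FD; first by rewrite expr0 divr1 expr1; exact: base.
  have D'0 : 0 < D / 2 ^+ k.+1 by rewrite divr_gt0.
  have L0 : 0 < D * s0 / 2 ^+ k by rewrite divr_gt0// mulr_gt0.
  have := covered_on_compose L0 (ih D F D0 FD) (fun G => base _ G D'0).
  apply: covered_on_weak => //.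
    (* The Lebesgue number of the new round is the smaller of the two, hence their minimum. *)
    rewrite le_min; apply/andP; split; last by rewrite mulrAC.
    rewrite ler_pM2l ?mulr_gt0//.
    by rewrite lef_pV2 ?posrE// exprS; have := pow2 k; lra.
  by rewrite -mulrA -invfM -exprSr.
(* This is the ratio of the diameter [D / 2 ^+ k.+1] to the Lebesgue number [D * s0 / 2 ^+ k],
   independent of [D] and [k]. *)
exists (2 * s0)^-1; first by rewrite invr_gt0 mulr_gt0.
move=> s s_gt0; apply: (covered_on_glue (x0 := x0)) => // n.
(* With [D] equal to [s * 2 ^+ k / s0], [iter k] gives exactly the Lebesgue number [s]; [k] is so
   large that this [D] bounds the diameter of the [n]-th ball. *)
pose k := Num.bound ((n%:R + n%:R) * s0 / s).
have nk : (n%:R + n%:R) * s0 / s < 2 ^+ k by exact: upper_nthrootP.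
have D0 : 0 < s * 2 ^+ k / s0 by rewrite divr_gt0// mulr_gt0.
have := iter k _ [set x : M | rd x0 x <= n%:R] D0.
have -> : s * 2 ^+ k / s0 * s0 / 2 ^+ k = s.
  by field; rewrite !gt_eqF.
have -> : s * 2 ^+ k / s0 / 2 ^+ k.+1 = (2 * s0)^-1 * s.
  by rewrite exprS; field; rewrite !gt_eqF.
apply=> x y /= xn yn.
rewrite ler_pdivlMr//; move: nk; rewrite ltr_pdivrMr// => nk.
have := rdist_trg S x0 x y; rewrite (rdistC S x x0) => xy.
have : rd x y * s0 <= (n%:R + n%:R) * s0 by rewrite ler_pM2r//; lra.
lra.
Qed.

Lemma covered_on_halvable (X : normedModType K) s D : 0 < s -> 0 < D ->
  covered_on [set: X] s D -> halvable X.
Proof.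
move=> s0 D0 Xcov; exists (s / (2 * D)); first by rewrite divr_gt0// mulr_gt0.
move=> D' F D'0 _.
(* Pulling back along the dilation by this factor turns the diameter bound [D] into [D' / 2]. *)
have c0 : 0 < 2 * D / D' by rewrite divr_gt0// mulr_gt0.
have := covered_on_scale (a := 0) (E := F) c0 (fun _ _ => I) Xcov.
have -> : s / (2 * D / D') = D' * (s / (2 * D)) by field; rewrite !gt_eqF.
by have -> : D / (2 * D / D') = D' / 2 by field; rewrite !gt_eqF.
Qed.

(** A nonempty set of diameter at most [D] is carried into the unit ball by moving one of its points
    to 0 and dividing by [D]. *)
Lemma unit_ball_halvable (X : normedModType K) s : 0 < s ->
  covered_on [set: unit_ball X] s (1 / 2) -> halvable X.
Proof.
move=> s0 Bcov.
have Xcov : covered_on [set x : X | `|x| <= 1] s (1 / 2).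
  have z : [set x : X | `|x| <= 1] 0 by rewrite /= normr0.
  (* Points outside the ball get the default value 0; only the values on the ball matter. *)
  pose f (x : X) : unit_ball X := match pselect ([set x : X | `|x| <= 1] x) with
    | left h => SigSub (mem_set h) | right _ => SigSub (mem_set z) end.
  have fK x : `|x| <= 1 -> set_val (f x) = x by rewrite /f; case: pselect.
  apply: (covered_on_pullback (f := f)) Bcov => // x y x1 y1;
    by rewrite rdist_subspace !fK.
exists s => // D F D0 FD.
have [[a Fa]|F0] := pselect (F !=set0); last first.
  exists set0; split=> //.
    move=> x; rewrite [X in finite_set X](_ : _ = set0)//.
    by apply/seteqP; split=> A // [].
  by move=> x Fx; case: F0; exists x.
have D10 : 0 < D^-1 by rewrite invr_gt0.
have := covered_on_scale (a := a) (E := F) D10 _ Xcov.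
rewrite invrK mulrC [_ * D]mulrC mulrA mulr1; apply=> x Fx /=.
rewrite normrZ ger0_norm ?real_inj_ge0 ?(ltW D10)//.
rewrite [`|x - a|](_ : _ = mdist a x)// (rdistE S) -rmorphM -(rmorph1 iota).
rewrite real_inj_le.
by rewrite ler_pdivrMl// mulr1; exact: FD.
Qed.

End halving.

(** * Covers of c0(Gamma) at all scales *)

Section c0_covers.
Context {R : realType} {K : numFieldType} (S : real_scalars R K) (Gamma : Type).
Local Notation iota := (real_inj S).
Local Notation rd := (rdist S).
Local Notation covered_on := (covered_on S).
Local Notation C0 := (c0 K Gamma).

(* The sets are the boxes of radius 7/8 about the functions with values in the
   lattice; where |x| <= 1/8, a box containing x has its centre at 0. *)
Lemma c0_covered_on : covered_on [set: C0] (1 / 8) 2.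
Proof.
pose box (k : Gamma -> K) : set C0 :=
  [set x | forall g, `|\val x g - k g| < iota (7 / 8)].
exists [set box k | k in [set k | forall g, lattice S (k g)]]; split.
- move=> x; pose s := [set g | iota (1 / 8) < `|\val x g|].
  have sfin : finite_set s.
    by have /asboolP := valP x; apply; rewrite real_inj_gt0.
  apply: sub_finite_set (finite_image box (finite_set_functions 0 sfin
    (fun g => lattice_finite S (\val x g)))).
  move=> _ [[k kL <-] kx]; exists k => // g; split=> [_|ng].
    split=> //; apply: (lt_le_trans (kx g)).
    by rewrite -(rmorph1 iota) real_inj_le; lra.
  apply: (lattice_discrete (kL g)).
  have xg : `|\val x g| <= iota (1 / 8).
    by rewrite real_leNgt ?normr_real ?gtr0_real ?real_inj_gt0//; exact/negP.
  rewrite -(subKr (\val x g) (k g)); apply: (le_lt_trans (ler_normB _ _)).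
  apply: (lt_le_trans (ler_ltD xg (kx g))).
  by rewrite -rmorphD -(rmorph1 iota) real_inj_le; lra.
- move=> x _.
  (* [k] rounds [x] in every coordinate with error at most [3/4]; the radius [7/8] of the box leaves
     [1/8] as Lebesgue number. *)
  have /choice[k kP] : forall g, exists l,
      lattice S l /\ `|\val x g - l| <= iota (3 / 4).
    by move=> g; have [l] := lattice_near S (\val x g); exists l.
  exists (box k); first by exists k => // g; have [] := kP g.
  move=> y _ xy g.
  have -> : \val y g - k g = (\val y g - \val x g) + (\val x g - k g).
    by rewrite addrA subrK.
  apply: (le_lt_trans (ler_normD _ _)).
  apply: (le_lt_trans (lerD (c0_rdist_ge S x y g) (kP g).2)).
  by rewrite -rmorphD real_inj_lt; lra.
- move=> _ x y [k kL <-] kx ky; apply: c0_rdist_le => // g.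
  have -> : \val y g - \val x g = (\val y g - k g) - (\val x g - k g).
    by rewrite opprB addrA subrK.
  apply: (le_trans (ler_normB _ _)).
  apply: (le_trans (lerD (ltW (ky g)) (ltW (kx g)))).
  by rewrite -rmorphD real_inj_le; lra.
Qed.

Lemma c0_covered_on_large s : 0 < s -> exists D, covered_on [set: C0] s D.
Proof.
move=> s0; have h : halvable S C0 by apply: covered_on_halvable c0_covered_on; lra.
by have [C C_gt0 Ccov] := halvable_covered_on (0 : C0) h; exists (C * s); exact: Ccov.
Qed.

Lemma c0_covered_on_small D : 0 < D -> exists2 s, 0 < s & covered_on [set: C0] s D.
Proof.
move=> D0; have h : halvable S C0 by apply: covered_on_halvable c0_covered_on; lra.
have [C C_gt0 Ccov] := halvable_covered_on (0 : C0) h.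
exists (D / C); first exact: divr_gt0.
have C0 : C != 0 by rewrite gt_eqF.
by have := Ccov _ (divr_gt0 D0 C_gt0); rewrite [C * _]mulrC divfK.
Qed.

End c0_covers.

(** * The bi-Lipschitz embedding *)

Section depth.
Context {R : realType} {K : numFieldType} (S : real_scalars R K).
Context {M : metricType K}.
Local Notation rd := (rdist S).
Implicit Types (W : set M) (x y : M).

Let depths W r x : set R := [set t | 0 <= t <= r /\ forall y, rd x y < t -> W y].

(* The distance from x to the complement of W, truncated at r. *)
Definition depth W r x : R := sup (depths W r x).

Let depths0 W r x : 0 <= r -> depths W r x 0.
Proof.
by move=> r0; split=> [|y]; [rewrite lexx r0|rewrite ltNge rdist_ge0].
Qed.

Let depths_ub W r x : ubound (depths W r x) r.
Proof. by move=> t [/andP[]]. Qed.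

Lemma depth_ge0 W r x : 0 <= r -> 0 <= depth W r x.
Proof.
by move=> r0; apply: ub_le_sup; [exists r; exact: depths_ub|exact: depths0].
Qed.

Lemma depth_le W r x : 0 <= r -> depth W r x <= r.
Proof. by move=> r0; apply: ge_sup; [exists 0; exact: depths0|exact: depths_ub]. Qed.

Lemma depth_full W r x : 0 <= r -> (forall y, rd x y < r -> W y) -> depth W r x = r.
Proof.
move=> r0 xW; apply/eqP; rewrite eq_le depth_le//=.
by apply: ub_le_sup; [exists r; exact: depths_ub|split=> //; rewrite r0 lexx].
Qed.

Lemma depth_out W r x : 0 <= r -> ~ W x -> depth W r x = 0.
Proof.
move=> r0 nWx; apply/eqP; rewrite eq_le depth_ge0// andbT.
apply: ge_sup; first by exists 0; exact: depths0.
move=> t [_ tW]; rewrite leNgt; apply/negP => t0; apply: nWx; apply: tW.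
by rewrite rdistxx.
Qed.

(** If [W] contains the ball of radius [t] about [u], it contains the ball of radius [t - rd u v]
    about [v]. *)
Lemma depth_lip W r x y : 0 <= r -> `|depth W r y - depth W r x| <= rd x y.
Proof.
move=> r0; have lip u v : depth W r u <= depth W r v + rd u v.
  apply: ge_sup; first by exists 0; exact: depths0.
  move=> t [/andP[t0 tr] tW].
  have [tuv|tuv] := leP t (rd u v).
    by rewrite (le_trans tuv)// lerDr depth_ge0.
  rewrite -lerBlDr; apply: ub_le_sup; first by exists r; exact: depths_ub.
  split=> [|z vz].
    by have uv := rdist_ge0 S u v; apply/andP; split; lra.
  by apply: tW; have := rdist_trg S v u z; lra.
rewrite ler_norml; have := lip x y; have := lip y x; rewrite (rdistC S y x).
by move=> h1 h2; apply/andP; split; lra.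
Qed.

End depth.

(** * Dyadic scales *)

Section dyadic.
Context {R : realType}.

Let dyadic_small (u : R) : 0 < u -> exists N : nat, 2 ^ (- N%:Z) < u.
Proof.
move=> u0; exists (Num.bound u^-1).
rewrite -exprnN -[u in ltRHS]invrK ltf_pV2 ?posrE ?invr_gt0 ?exprn_gt0//.
exact: upper_nthrootP.
Qed.

Lemma dyadic_between (u : R) : 0 < u -> exists n : int, 2 ^ n < u <= 2 ^ (n + 1).
Proof.
move=> u0; have [N uN] := dyadic_small u0.
(* Shifting exponents by [N] reduces to a minimum over natural numbers, which is not 0 because
   [2 ^ (- N) < u]. *)
pose p (m : nat) := u <= 2 ^ (m%:Z - N%:Z).
have pex : exists m, p m.
  exists (Num.bound u + N)%N; rewrite /p PoszD addrK; apply/ltW.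
  exact: (@upper_nthrootP _ u (Num.bound u)).
case: (ex_minnP pex) => -[|m] pm mmin.
  by move: pm; rewrite /p sub0r leNgt uN.
exists (m%:Z - N%:Z); apply/andP; split.
  by rewrite ltNge; apply/negP => /mmin; rewrite ltnn.
by have <- : m.+1%:Z - N%:Z = m%:Z - N%:Z + 1 by lia.
Qed.

Lemma finite_dyadic (r t : R) : 0 < r -> finite_set [set n : int | r < 2 ^ n <= t].
Proof.
move=> r0; have [N rN] := dyadic_small r0.
apply: sub_finite_set (finite_image (fun m : nat => m%:Z - N%:Z)
  (finite_II (Num.bound t + N))).
move=> n /andP[rn nt].
have Nn : - N%:Z < n by rewrite -(@ltr_eXz2l R 2) ?ltr1n//; exact: lt_trans rn.
have nb : n < Num.bound t.
  rewrite -(@ltr_eXz2l R 2) ?ltr1n//; apply: (le_lt_trans nt).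
  exact: (@upper_nthrootP _ t (Num.bound t)).
by exists `|(n + N%:Z)%R|%N => /=; lia.
Qed.

End dyadic.

Section embedding.
Context {R : realType} {K : numFieldType} (S : real_scalars R K).
Context {X : normedModType K}.
Local Notation iota := (real_inj S).
Local Notation rd := (rdist S).
Local Notation covered_on := (covered_on S).

(* Coordinates are indexed by a scale 2^n and a member V of a point-finite family
   for that scale. Removing the ball of radius 2^n about 0 from V makes all the
   coordinates of scale 2^n > |x| vanish at x, and does not affect points at
   distance at least 2 * 2^n from 0. *)
Lemma covered_on_embedding C : 0 < C ->
  (forall s, 0 < s -> covered_on [set: X] s (C * s)) ->
  exists (Gamma : Type) (f : X -> c0 K Gamma), bilipschitz_embedding f.
Proof.
move=> C0 Xcov.
have /choice[V VP] : forall n : int, exists V : set (set X), [/\ point_finite V,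
    forall x, exists2 A, V A & forall y, rd x y < 2 ^ n -> A y &
    forall A x y, V A -> A x -> A y -> rd x y <= C * 2 ^ n].
  move=> n; have [|V [Vfin Vleb Vdiam]] := Xcov (2 ^ n); first by rewrite exprz_gt0.
  exists V; split=> // x; have [//|A VA xA] := Vleb x.
  by exists A => // y; exact: xA.
pose W n A : set X := [set z | [/\ V n A, A z & 2 ^ n <= rd (0 : X) z]].
have pow2 (n : int) : (0 : R) < 2 ^ n by rewrite exprz_gt0.
pose h (x : X) (g : int * set X) : K^o := iota (depth S (W g.1 g.2) (2 ^ g.1) x).
have hc0 x : c0_pred (h x).
  apply/asboolP => e /(real_inj_pos S)[r r0 ->].
  (* A coordinate is at most [2 ^ n], and vanishes unless the member contains [x] and [2 ^ n] is at
     most the norm of [x]: this leaves finitely many scales, with finitely many members at each. *)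
  apply: (@sub_finite_set _ _ (\bigcup_(n in
      [set n : int | r < 2 ^ n <= rd (0 : X) x])
      [set (n, A) | A in [set A | V n A /\ A x]])).
    move=> [n A] /=; rewrite real_inj_norm real_inj_lt.
    rewrite ger0_norm ?depth_ge0 ?(ltW (pow2 n))//.
    move=> rd0; have [[VA Ax nx]|nW] := pselect (W n A x); last first.
      by move: rd0; rewrite depth_out ?(ltW (pow2 n))//; lra.
    exists n; last by exists A.
    rewrite /= nx andbT; apply: (lt_le_trans rd0).
    by rewrite depth_le ?(ltW (pow2 n)).
  apply: bigcup_finite; first exact: finite_dyadic.
  by move=> n _; apply: finite_image; have [+ _ _] := VP n; apply.
(* Each coordinate is 1-Lipschitz, whence the upper bound for [f]; the lower bound comes from one
   coordinate at a scale comparable to the distance. *)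
pose f x : c0 K (int * set X) := exist (fun x => c0_pred x) (h x) (hc0 x).
have fE x g : \val (f x) g = iota (depth S (W g.1 g.2) (2 ^ g.1) x) by [].
(* Once [C' * 2 ^ n < rd u v], the summand [C] puts [v] outside every member containing [u], and the
   summand [4] makes the norm of [u] at least [2 * 2 ^ n] if [v] has no larger norm. *)
pose C' := C + 4.
exists (int * set X)%type, f.
apply: (@bilipschitz_of_bounds _ _ S _ _ f 1 (2 * C')) => //.
- by rewrite /C'; lra.
- move=> x y; rewrite mul1r; apply: c0_rdist_le; first exact: rdist_ge0.
  move=> g; rewrite !fE -rmorphB real_inj_norm real_inj_le.
  exact/depth_lip/ltW.
move=> x y; have [xy0|xy0] := leP (rd x y) 0.
  by apply: (le_trans xy0); rewrite mulr_ge0 ?rdist_ge0// /C'; lra.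
have C'0 : 0 < C' by rewrite /C'; lra.
have [|n /andP[nl nu]] := @dyadic_between R (rd x y / C').
  exact: divr_gt0.
(* Let [u] be the point not nearer to 0: some coordinate of scale [2 ^ n] is [2 ^ n] at [u] and 0 at
   [v]. *)
suff far u v : rd u v = rd x y -> rd (0 : X) v <= rd (0 : X) u ->
    2 ^ n <= rd (f u) (f v).
  have nf : 2 ^ n <= rd (f x) (f y).
    have [h0|/ltW h0] := leP (rd (0 : X) y) (rd (0 : X) x); first exact: far.
    by rewrite rdistC; apply: far => //; exact: rdistC.
  move: nu; rewrite ler_pdivrMr// expfzDr ?pnatr_eq0// expr1z => nu.
  by apply: (le_trans nu); rewrite -mulrA mulrC ler_pM2l// mulr_gt0.
move=> uv vu; have nn := pow2 n.
have nl' : C' * 2 ^ n < rd u v by rewrite uv mulrC -ltr_pdivlMr.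
have u2 : 2 * 2 ^ n <= rd (0 : X) u.
  by have := rdist_trg S (0 : X) u v; rewrite (rdistC S u (0 : X)) /C' in nl' *; nra.
have [_ Vleb Vdiam] := VP n; have [A VA uA] := Vleb u.
have := c0_rdist_ge S (f u) (f v) (n, A); rewrite !fE /=.
rewrite [depth _ _ _ v]depth_out ?(ltW nn)//; last first.
  move=> [_ Av _]; have Au : A u by apply: uA; rewrite rdistxx.
  by have := Vdiam _ _ _ VA Au Av; move: nl'; rewrite /C'; nra.
rewrite [depth _ _ _ u]depth_full ?(ltW nn)//; last first.
  move=> z uz; split=> //; first exact: uA.
  by have := rdist_trg S z (0 : X) u; rewrite (rdistC S z u); lra.
by rewrite rmorph0 sub0r normrN real_inj_norm real_inj_le ger0_norm// ltW.
Qed.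

End embedding.

(** * The cycle of implications between the nine statements *)

Theorem theorem14 (R : realType) (K : numFieldType)
    (hK : real_or_complex R K) (X : normedModType K) :
  [<-> rpc_le X nat;
       uniform_stone X;
       coarse_stone X;
       exists (Gamma : Type) (f : X -> c0 K Gamma), coarse_embedding f;
       exists (Gamma : Type) (f : X -> c0 K Gamma), uniform_embedding f;
       exists (Gamma : Type) (f : X -> c0 K Gamma), bilipschitz_embedding f;
       rpc_le (unit_ball X) nat;
       exists (Gamma : Type) (f : unit_ball X -> c0 K Gamma),
         uniform_embedding f;
       exists (Gamma : Type) (f : unit_ball X -> c0 K Gamma),
         bilipschitz_embedding f].
Proof.
have [S] := real_or_complex_scalars hK.
pose h := halvable S X.
have z1 : [set x : X | `|x| <= 1] 0 by rewrite /= normr0.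
pose b0 : unit_ball X := SigSub (mem_set z1).
have small_c0 Gamma := @c0_covered_on_small R K S Gamma.
have half_gt0 : 0 < 1 / 2 :> R by rewrite divr_gt0.
have cov C : 0 < C -> forall s, 0 < s -> covered_on S [set: X] s C -> h.
  by move=> C0 s s0; exact: covered_on_halvable.
have h_cov : h -> exists2 C, 0 < C &
    forall s, 0 < s -> covered_on S [set: X] s (C * s).
  exact: (halvable_covered_on (0 : X)).
have stone_h : uniform_stone X -> h.
  by move=> /(stone_covered_on S)/(_ ltr01)[s s0]; exact: cov.
have coarse_h : coarse_stone X -> h.
  by move=> /(coarse_stone_covered_on S)[D D0]; exact: cov.
have coarse_emb_h Gamma (f : X -> c0 K Gamma) : coarse_embedding f -> h.
  move=> /coarse_embedding_covered_on/(_ (@c0_covered_on_large R K S Gamma)).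
  by move=> [D D0]; exact: cov.
have unif_emb_h Gamma (f : X -> c0 K Gamma) : uniform_embedding f -> h.
  move=> /uniform_embedding_covered_on/(_ (small_c0 Gamma) 1 ltr01)[s s0].
  exact: cov.
have ball_h : uniform_stone (unit_ball X) -> h.
  by move=> /(stone_covered_on S)/(_ half_gt0)[s s0]; exact: unit_ball_halvable.
have ball_emb_h Gamma (f : unit_ball X -> c0 K Gamma) : uniform_embedding f -> h.
  move=> /uniform_embedding_covered_on/(_ (small_c0 Gamma) _ half_gt0)[s s0].
  exact: unit_ball_halvable.
have h_bilip : h -> exists (Gamma : Type) (f : X -> c0 K Gamma),
    bilipschitz_embedding f.
  by move=> /h_cov[C C0]; exact: covered_on_embedding.
have h_stone : h -> uniform_stone X.
  move=> /h_bilip[Gamma [f /(bilipschitz_uniform S) fu]].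
  apply: (covered_on_stone (S := S)).
  exact: uniform_embedding_covered_on fu (small_c0 Gamma).
have h_ball : h -> exists (Gamma : Type) (f : unit_ball X -> c0 K Gamma),
    bilipschitz_embedding f.
  move=> /h_bilip[Gamma [f fb]]; exists Gamma.
  by exists (fun u => f (set_val u)); exact: (bilipschitz_subspace S).
(* Every implication passes through [h], except (i) to (ii) and (vi) to (vii); the latter pulls
   covers of c0 back to the unit ball. *)
tfae.
- exact: rpc_le_stone.
- move=> /stone_h/h_cov[C C0 Ccov].
  apply: (covered_on_coarse_stone (S := S) (0 : X)) => s s0; exists (C * s).
  exact: Ccov.
- move=> /coarse_h/h_bilip[Gamma [f fb]]; exists Gamma, f.
  exact: (bilipschitz_coarse S).
- move=> [Gamma [f /coarse_emb_h/h_bilip[G [g gb]]]]; exists G, g.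
  exact: (bilipschitz_uniform S).
- by move=> [Gamma [f /unif_emb_h/h_bilip]].
- move=> [Gamma [f fb]].
  apply: (stone_rpc_le b0).
  apply: (covered_on_stone (S := S)).
  apply: uniform_embedding_covered_on (small_c0 Gamma).
  exact: (bilipschitz_uniform S) (bilipschitz_subspace S _ fb).
- move=> /rpc_le_stone/ball_h/h_ball[Gamma [f fb]]; exists Gamma, f.
  exact: (bilipschitz_uniform S).
- by move=> [Gamma [f /ball_emb_h/h_ball]].
- move=> [Gamma [f /(bilipschitz_uniform S)/ball_emb_h/h_stone]].
  exact: (stone_rpc_le (0 : X)).
Qed.
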